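(* Let $\mathcal{S}$ be an anti-negative semifield and $n$ a positive integer. If a bijective $\mathcal{S}$-linear transformation on $M_n(\mathcal{S})$ preserves any of $\mathcal{L}$, $\mathcal{R}$, $\le_{\mathcal{L}}$ and $\le_{\mathcal{R}}$, then it strongly preserves $\mathcal{L}$, $\mathcal{R}$, $\mathcal{D}$, $\mathcal{J}$, $\mathcal{H}$, $\le_{\mathcal{L}}$, $\le_{\mathcal{R}}$ and $\le_{\mathcal{J}}$.
   Context: A semiring is a set $\mathcal{S}$ with addition and multiplication such that $\mathcal{S}$ is a commutative monoid under addition with identity $0_{\mathcal{S}}$, a semigroup under multiplication, multiplication distributes over addition on both sides, and $s0_{\mathcal{S}}=0_{\mathcal{S}}s=0_{\mathcal{S}}$ for all $s$. It is a semifield if $\mathcal{S}\setminus\{0_{\mathcal{S}}\}$ is an abelian group under multiplication (with identity $1_{\mathcal{S}}$). It is anti-negative if $a+b=0_{\mathcal{S}}$ implies $a=b=0_{\mathcal{S}}$. $M_n(\mathcal{S})$ is the set of $n\times n$ matrices over $\mathcal{S}$, viewed as a monoid under matrix multiplication and as an $\mathcal{S}$-module entrywise. $\mathcal{S}$-linear means additive and compatible with scalar multiplication. In the monoid $\mathcal{M}=M_n(\mathcal{S})$: $a\le_{\mathcal{R}} b$ iff $a=bs$ for some $s\in\mathcal{M}$; $a\le_{\mathcal{L}} b$ iff $a=sb$ for some $s\in\mathcal{M}$; $a\le_{\mathcal{J}} b$ iff $a=sbt$ for some $s,t\in\mathcal{M}$; for each of $\mathcal{K}=\mathcal{R},\mathcal{L},\mathcal{J}$,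 $a\,\mathcal{K}\,b$ iff $a\le_{\mathcal{K}}b$ and $b\le_{\mathcal{K}}a$; $a\,\mathcal{H}\,b$ iff $a\,\mathcal{R}\,b$ and $a\,\mathcal{L}\,b$; $a\,\mathcal{D}\,b$ iff there is $c\in\mathcal{M}$ with $a\,\mathcal{R}\,c$ and $c\,\mathcal{L}\,b$. For a map $T:M_n(\mathcal{S})\to M_n(\mathcal{S})$: $T$ preserves a relation $\mathcal{P}$ if $A\,\mathcal{P}\,B$ implies $T(A)\,\mathcal{P}\,T(B)$ for all $A,B$; $T$ strongly preserves $\mathcal{P}$ if $A\,\mathcal{P}\,B\iff T(A)\,\mathcal{P}\,T(B)$ for all $A,B$. *)

(* Defs.v *)
From mathcomp Require Import all_boot all_order all_algebra.

Set Implicit Arguments.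
Unset Strict Implicit.
Unset Printing Implicit Defensive.

Import GRing.Theory.
Local Open Scope ring_scope.

(* comNzSemiRingType already provides 1 != 0 and commutativity, so inverses
   are all that is missing for S \ {0} to be an abelian group. *)
Definition semifield (S : comNzSemiRingType) : Prop :=
  forall x : S, x != 0 -> exists y : S, x * y = 1.

Definition anti_negative (S : nmodType) : Prop :=
  forall a b : S, a + b = 0 -> a = 0 /\ b = 0.

Section Green.
Variables (S : pzSemiRingType) (n : nat).
Implicit Types A B C U V : 'M[S]_n.

Definition green_leR A B : Prop := exists U, A = B *m U.
Definition green_leL A B : Prop := exists U, A = U *m B.
Definition green_leJ A B : Prop := exists U V, A = U *m B *m V.

Definition greenR A B : Prop := green_leR A B /\ green_leR B A.
Definition greenL A B : Prop := green_leL A B /\ green_leL B A.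
Definition greenJ A B : Prop := green_leJ A B /\ green_leJ B A.
Definition greenH A B : Prop := greenR A B /\ greenL A B.
Definition greenD A B : Prop := exists C, greenR A C /\ greenL C B.

End Green.

Section Preservers.
Variables (M : Type) (P : M -> M -> Prop) (T : M -> M).

Definition preserves : Prop := forall A B, P A B -> P (T A) (T B).
Definition strongly_preserves : Prop := forall A B, P A B <-> P (T A) (T B).

End Preservers.

(* Main.v *)
Require Import Defs.
From mathcomp Require Import all_boot all_order all_algebra.

Set Implicit Arguments.
Unset Strict Implicit.
Unset Printing Implicit Defensive.

Import GRing.Theory.
Local Open Scope ring_scope.

(** A sum in an anti-negative semifield vanishes only if every term does, and
    there are no zero divisors, so no cancellation can occur.  This forces a
    linear bijection [T] to permute the matrix units [delta_mx i j] up to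
    nonzero scalars ([linear_bij_monomial]): a unit is a sum of matrices only
    when all of them are multiples of it, and [T] carries this property over.

    Suppose now that [T] preserves the relation L, mutual generation of rows.
    Two units of the same column are L-related, and L-related matrices have the
    same zero columns, so the new column index depends on the old column only.
    A matrix with a single row of ones is L-related to the all-ones matrix,
    whose image has no zero entry; hence every nonzero row in the image of the
    former has no zero entry, so the image of a row is again a row.  Thus the
    permutation of the units is a product of a row permutation [tau] and a
    column permutation [pi].  Finally the one-row matrices of ones are pairwise
    L-related, so the rows of scalars of [T] are proportional.  Altogether
    [T A = P *m A *m Q] with [P], [Q] invertible monomial matrices
    ([preserves_greenL_equivalence]).

    Transposition exchanges L and R, which gives the same form when [T]
    preserves R; preserving one of the preorders implies preserving the
    equivalence associated with it.  Conversely, maps [A |-> P *m A *m Q] with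
    invertible [P], [Q] strongly preserve all of Green's relations, because the
    multipliers witnessing a relation can be conjugated by [P] or [Q]
    ([equivalence_map_strongly_preserves]). *)

(** * Multiplication by invertible matrices on both sides *)

Definition mutually_inverse (S : pzSemiRingType) n (P P' : 'M[S]_n) : Prop :=
  P *m P' = 1%:M /\ P' *m P = 1%:M.

(** The inverses are part of the data: over a semiring there is no determinant
    from which to read off invertibility. *)
Definition equivalence_map (S : pzSemiRingType) n (T : 'M[S]_n -> 'M[S]_n) :
    Prop :=
  exists P P' Q Q', [/\ mutually_inverse P P', mutually_inverse Q Q'
    & forall A, T A = P *m A *m Q].

Section EquivalenceMaps.
Variables (S : pzSemiRingType) (n : nat).
Implicit Types (A B : 'M[S]_n) (T : 'M[S]_n -> 'M[S]_n).

(** Closure under inversion reduces strong preservation to preservation. *)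
Lemma equivalence_map_inv T : equivalence_map T ->
  exists T', [/\ equivalence_map T', cancel T T' & cancel T' T].
Proof.
case=> P [P' [Q [Q' [[PP' P'P] [QQ' Q'Q] defT]]]].
exists (fun A => P' *m A *m Q'); split.
- by exists P', P, Q', Q; split.
- by move=> A; rewrite defT !mulmxA P'P mul1mx -mulmxA QQ' mulmx1.
- by move=> A; rewrite defT !mulmxA PP' mul1mx -mulmxA Q'Q mulmx1.
Qed.

(** If [A = U *m B], then [P *m A *m Q = (P *m U *m P') *m (P *m B *m Q)] where
    [P'] is the inverse of [P]; multipliers on the right are conjugated by [Q]
    in the same way. *)
Lemma equivalence_map_preserves T : equivalence_map T ->
  [/\ preserves (@green_leL S n) T, preserves (@green_leR S n) T
    & preserves (@green_leJ S n) T].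
Proof.
case=> P [P' [Q [Q' [[PP' P'P] [QQ' Q'Q] defT]]]].
have PK C : P' *m (P *m C) = C by rewrite mulmxA P'P mul1mx.
have QK C : Q *m (Q' *m C) = C by rewrite mulmxA QQ' mul1mx.
split=> A B.
- by case=> U ->; exists (P *m U *m P'); rewrite !defT -!mulmxA PK.
- by case=> U ->; exists (Q' *m U *m Q); rewrite !defT -!mulmxA QK.
- case=> U [V ->]; exists (P *m U *m P'), (Q' *m V *m Q).
  by rewrite !defT -!mulmxA PK QK.
Qed.

Lemma equivalence_map_strongly_preserves T : equivalence_map T ->
  strongly_preserves (@greenL S n) T /\
  strongly_preserves (@greenR S n) T /\
  strongly_preserves (@greenD S n) T /\
  strongly_preserves (@greenJ S n) T /\
  strongly_preserves (@greenH S n) T /\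
  strongly_preserves (@green_leL S n) T /\
  strongly_preserves (@green_leR S n) T /\
  strongly_preserves (@green_leJ S n) T.
Proof.
move=> eqT; have [T' [eqT' TK T'K]] := equivalence_map_inv eqT.
have [TL TR TJ] := equivalence_map_preserves eqT.
have [TL' TR' TJ'] := equivalence_map_preserves eqT'.
have strong r : preserves r T -> preserves r T' -> strongly_preserves r T.
  by move=> rT rT' A B; split=> [/rT | /rT'] //; rewrite !TK.
have sL := strong _ TL TL'; have sR := strong _ TR TR'.
have sJ := strong _ TJ TJ'.
have both r : strongly_preserves r T ->
    strongly_preserves (fun A B => r A B /\ r B A) T.
  by move=> rT A B; have := rT A B; have := rT B A; tauto.
have sGL : strongly_preserves (@greenL S n) T := both _ sL.
have sGR : strongly_preserves (@greenR S n) T := both _ sR.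
have sGJ : strongly_preserves (@greenJ S n) T := both _ sJ.
have sGH : strongly_preserves (@greenH S n) T.
  by move=> A B; have := sGR A B; have := sGL A B; rewrite /greenH; tauto.
have sGD : strongly_preserves (@greenD S n) T.
  move=> A B; split=> [] [C [RAC LCB]].
    by exists (T C); split; [exact: (sGR _ _).1 | exact: (sGL _ _).1].
  by exists (T' C); split; [apply: (sGR _ _).2 | apply: (sGL _ _).2];
    rewrite T'K.
by split; last do 6?[split=> //].
Qed.

End EquivalenceMaps.

(** With [greenL_trmx], this reduces the preservers of R to those of L. *)
Lemma equivalence_map_trmx (S : comPzSemiRingType) n
    (T : 'M[S]_n -> 'M[S]_n) :
  equivalence_map (trmx \o T \o trmx) -> equivalence_map T.
Proof.
have invT (P P' : 'M[S]_n) : mutually_inverse P P' -> mutually_inverse P^T P'^T.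
  by case=> PP' P'P; split; rewrite -trmx_mul ?PP' ?P'P trmx1.
case=> P [P' [Q [Q' [PP' QQ' defT]]]].
exists Q^T, Q'^T, P^T, P'^T; split; try exact: invT.
by move=> A; have := defT A^T; rewrite /= trmxK => /(canRL trmxK)->;
  rewrite !trmx_mul trmxK mulmxA.
Qed.

Lemma greenL_trmx (S : comPzSemiRingType) n (A B : 'M[S]_n) :
  greenL A B <-> greenR A^T B^T.
Proof.
have le (C D : 'M[S]_n) : green_leL C D <-> green_leR C^T D^T.
  split=> [[U ->]|[U /(canRL trmxK)->]]; exists U^T; first exact: trmx_mul.
  by rewrite trmx_mul trmxK.
by have := le A B; have := le B A; rewrite /greenL /greenR; tauto.
Qed.

(** * Linear bijections over an anti-negative semifield *)

Section Semifield.
Variable S : comNzSemiRingType.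
Hypotheses (fieldS : semifield S) (antiS : anti_negative S).

Lemma semifield_mulf_eq0 (x y : S) : x != 0 -> x * y = 0 -> y = 0.
Proof.
move=> /fieldS[z xz1] xy0.
by rewrite -[y]mul1r -xz1 mulrAC xy0 mul0r.
Qed.

Lemma anti_negative_sum_eq0 (I : finType) (F : I -> S) :
  \sum_i F i = 0 -> forall i, F i = 0.
Proof. by move=> sum0 i; move: sum0; rewrite (bigD1 i) //= => /antiS[]. Qed.

(** Write [T (E p) = \sum_q c q *: E q] and apply the inverse map [T']: the unit
    [E p] is [\sum_q c q *: T' (E q)].  Without cancellation, [c q != 0] forces
    [T' (E q)] to be a multiple of [E p], so [T (E p)] is a multiple of [E q]. *)
Lemma linear_bij_monomial n (T : {linear 'M[S]_n -> 'M[S]_n}) : bijective T ->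
  exists (s : 'I_n * 'I_n -> 'I_n * 'I_n) (b : 'I_n * 'I_n -> S),
    [/\ injective s, forall p, b p != 0
      & forall A p, T A (s p).1 (s p).2 = b p * A p.1 p.2].
Proof.
move=> bijT; have injT := bij_inj bijT; case: bijT => T' TK T'K.
pose E (p : 'I_n * 'I_n) : 'M[S]_n := delta_mx p.1 p.2.
have EE p q : E p q.1 q.2 = (q == p)%:R by rewrite mxE -pair_eqE.
have Edef (A : 'M[S]_n) : A = \sum_p A p.1 p.2 *: E p.
  by have := matrix_sum_delta A; rewrite pair_bigA.
have mx_eq0 (A : 'M[S]_n) : (forall p, A p.1 p.2 = 0) -> A = 0.
  by move=> A0; apply/matrixP=> i j; rewrite (A0 (i, j)) mxE.
have TE p : exists (qc : ('I_n * 'I_n) * S),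
    qc.2 != 0 /\ T (E p) = qc.2 *: E qc.1.
  pose c q := T (E p) q.1 q.2.
  have [q cq0] : exists q, c q != 0.
    apply/existsP; apply: contraT => /existsPn c0.
    have /injT Ep0 : T (E p) = T 0.
      by rewrite linear0; apply: mx_eq0 => q; apply/eqP/negbNE/c0.
    by move: (EE p p); rewrite Ep0 eqxx mxE => /esym/eqP; rewrite oner_eq0.
  have Ep : E p = \sum_r c r *: T' (E r).
    apply: injT; rewrite linear_sum [LHS]Edef; apply: eq_bigr => r _.
    by rewrite linearZ /= T'K.
  pose d := T' (E q) p.1 p.2.
  have T'E : T' (E q) = d *: E p.
    rewrite [LHS]Edef (bigD1 p) //= big1 ?addr0 // => r rp.
    have := EE p r; rewrite {1}Ep summxE (negPf rp) => /anti_negative_sum_eq0.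
    by move/(_ q); rewrite mxE => /(semifield_mulf_eq0 cq0) ->; rewrite scale0r.
  have dT : E q = d *: T (E p) by rewrite -linearZ -T'E T'K.
  have dc : d * c q = 1 by have := EE q q; rewrite {1}dT mxE eqxx.
  by exists (q, c q); split=> //=; rewrite dT scalerA mulrC dc scale1r.
have [sb sbP] := fin_all_exists TE.
pose s p := (sb p).1; pose b p := (sb p).2.
have b0 p : b p != 0 by case: (sbP p).
have {}TE p : T (E p) = b p *: E (s p) by case: (sbP p).
have s_inj : injective s.
  move=> p q spq; apply/eqP; apply: contraT => pq.
  (* If p and q had the same image position, suitable multiples of E p and E q
     would have the same image under T. *)
  have /injT/matrixP/(_ p.1 p.2) : T (b q *: E p) = T (b p *: E q).
    by rewrite !linearZ /= !TE spq !scalerA mulrC.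
  rewrite [LHS]mxE [RHS]mxE !EE eqxx (negPf pq) mulr1 mulr0 => bq0.
  by have := b0 q; rewrite bq0 eqxx.
exists s, b; split=> // A p.
rewrite [A in LHS]Edef linear_sum summxE (bigD1 p) //= big1 => [|q qp].
  by rewrite addr0 linearZ /= TE [LHS]mxE [X in _ * X]mxE EE eqxx mulr1 mulrC.
rewrite linearZ /= TE [LHS]mxE [X in _ * X]mxE EE (inj_eq s_inj).
by rewrite eq_sym (negPf qp) !mulr0.
Qed.

(** * Monomial matrices *)

Section Monomial.
Variable n : nat.
Implicit Types (f g : 'I_n -> 'I_n) (x y : 'I_n -> S).

Definition monomial_mx f x : 'M[S]_n := \matrix_(a, i) (x i *+ (f i == a)).

Lemma monomial_mxM f g x y : monomial_mx f x *m monomial_mx g y =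
  monomial_mx (f \o g) (fun i => x (g i) * y i).
Proof.
apply/matrixP=> a i; rewrite !mxE (bigD1 (g i)) //= big1 => [|k kg].
  by rewrite !mxE eqxx addr0 mulrnAl.
by rewrite !mxE [g i == k]eq_sym (negPf kg) mulr0.
Qed.

Lemma mul_monomial_mxE f x (A : 'M_n) i j : injective f ->
  (monomial_mx f x *m A) (f i) j = x i * A i j.
Proof.
move=> f_inj; rewrite mxE (bigD1 i) //= big1 => [|k ki].
  by rewrite mxE eqxx addr0.
by rewrite mxE (inj_eq f_inj) (negPf ki) mul0r.
Qed.

(** The inverse carries the inverse scalars along the inverse permutation. *)
Lemma monomial_mx_inv f x : injective f -> (forall i, x i != 0) ->
  exists P', mutually_inverse (monomial_mx f x) P'.
Proof.
move=> /injF_bij[g fK gK] x0.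
have [y xy] := fin_all_exists (fun i => fieldS (x0 i)).
have one h z : h =1 id -> z =1 (fun=> 1) -> monomial_mx h z = 1%:M.
  by move=> hE zE; apply/matrixP=> a i; rewrite !mxE hE zE eq_sym.
exists (monomial_mx g (y \o g)); split; rewrite monomial_mxM; apply: one => //.
by move=> i /=; rewrite fK mulrC xy.
Qed.

End Monomial.

(** * Preservers of L *)

(** When row [i] of [A] is a combination of the rows of [B], some row [k] of [B]
    that enters it with nonzero coefficient is nonzero in column [j]; a zero of
    [A] in row [i] is then a zero of that row [k], since nothing cancels. *)
Lemma green_leL_neq0 n (A B : 'M[S]_n) i j l :
  green_leL A B -> A i j != 0 -> A i l = 0 -> exists2 k, B k j != 0 & B k l = 0.
Proof.
case=> U -> Aij; rewrite mxE => /anti_negative_sum_eq0 Ail.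
have [k Uk] : exists k, U i k * B k j != 0.
  apply/existsP; apply: contraNT Aij => /existsPn UB0.
  by rewrite mxE big1 // => k _; apply/eqP/negbNE/UB0.
exists k; first by apply: contraNneq Uk => ->; rewrite mulr0.
apply: semifield_mulf_eq0 (Ail k).
by apply: contraNneq Uk => ->; rewrite mul0r.
Qed.

(** The three uses of the hypothesis are [colE], where two units of one column
    are compared, [rowE], where a row of ones is compared with the all-ones
    matrix, and [b_rank1], where two rows of ones are compared. *)
Theorem preserves_greenL_equivalence n (T : {linear 'M[S]_n.+1 -> 'M[S]_n.+1}) :
  bijective T -> preserves (@greenL S n.+1) T -> equivalence_map T.
Proof.
move=> bijT presT.
have [s [b [s_inj b0 TE]]] := linear_bij_monomial bijT.
have s_onto q : exists p, s p = q.
  by have /codomP[p ->] := injF_onto s_inj q; exists p.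
(* If the two columns differed, the image of the second unit would be zero in the
   column of the first, hence so would be each of its left multiples. *)
have colE i k j : (s (i, j)).2 = (s (k, j)).2.
  have [] : greenL (T (delta_mx i j)) (T (delta_mx k j)).
    by apply: presT; split; [exists (delta_mx i k) | exists (delta_mx k i)];
      rewrite mul_delta_mx.
  have Tij : T (delta_mx i j) (s (i, j)).1 (s (i, j)).2 != 0.
    by rewrite TE mxE !eqxx mulr1.
  move=> [U defU] _; apply/eqP; apply: contraT => ne.
  move: Tij; rewrite defU mxE big1 ?eqxx // => a _.
  have [p sp] := s_onto (a, (s (i, j)).2).
  have -> : a = (s p).1 by rewrite sp.
  have <- : (s p).2 = (s (i, j)).2 by rewrite sp.
  rewrite TE mxE; case: andP => [[/eqP pk /eqP pj]|]; last by rewrite !mulr0.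
  by move: ne; rewrite -pk -{2}pj -surjective_pairing sp eqxx.
pose pi j := (s (ord0, j)).2.
have pi_onto l : exists j, pi j = l.
  have [[i j] sij] := s_onto (ord0, l).
  by exists j; rewrite /pi (colE _ i) sij.
have [pi' pi'K] := fin_all_exists pi_onto.
have pi_inj : injective pi := can_inj (canF_sym pi'K).
pose J (v : 'I_n.+1 -> S) : 'M[S]_n.+1 := \matrix_(i, j) v i.
pose R i : 'M[S]_n.+1 := J (fun k => (k == i)%:R).
have R_le i v : v i = 1 -> green_leL (R i) (J v).
  move=> vi; exists (delta_mx i i); apply/matrixP=> k l.
  rewrite !mxE (bigD1 i) //= big1 => [|a ai].
    by rewrite !mxE vi eqxx andbT mulr1 addr0.
  by rewrite mxE (negPf ai) andbF mul0r.
have le_R i v : green_leL (J v) (R i).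
  exists (\matrix_(k, a) v k); apply/matrixP=> k l.
  rewrite !mxE (bigD1 i) //= big1 => [|a ai].
    by rewrite !mxE eqxx mulr1 addr0.
  by rewrite !mxE (negPf ai) mulr0.
have R_J i v : v i = 1 -> greenL (T (R i)) (T (J v)).
  by move=> vi; apply: presT; split; auto.
(* If units j and l of row i went to different rows, the row of T (R i) that
   contains the image of the j-th one would have a zero in column pi l, whereas
   the image of the all-ones matrix has no zero entry. *)
have rowE i j l : (s (i, j)).1 = (s (i, l)).1.
  apply/eqP; apply: contraT => ne.
  have [RJ _] := R_J i (fun=> 1) erefl.
  have [[i' l'] sil] := s_onto ((s (i, j)).1, pi l).
  have ll' : l' = l by apply: pi_inj; rewrite /pi (colE _ i') sil.
  have Rj : T (R i) (s (i, j)).1 (s (i, j)).2 != 0.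
    by rewrite TE !mxE eqxx mulr1.
  have Rl : T (R i) (s (i, j)).1 (pi l) = 0.
    have := TE (R i) (i', l'); rewrite sil /= => ->; rewrite !mxE.
    case: eqP => [ii'|]; last by rewrite mulr0.
    by move: ne; rewrite -ll' -{2}ii' sil eqxx.
  have [k _] := green_leL_neq0 RJ Rj Rl.
  have [p sp] := s_onto (k, pi l).
  have := TE (J (fun=> 1)) p; rewrite sp /= => -> /eqP.
  by rewrite mxE mulr1 (negPf (b0 p)).
pose tau i := (s (i, ord0)).1.
have sE i j : s (i, j) = (tau i, pi j).
  by rewrite [LHS]surjective_pairing (rowE i j ord0) (colE i ord0 j).
have {}TE A i j : T A (tau i) (pi j) = b (i, j) * A i j.
  by have := TE A (i, j); rewrite sE.
have tau_inj : injective tau.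
  move=> i k tik; have : s (i, ord0) = s (k, ord0) by rewrite !sE tik.
  by case/s_inj.
have [tau' tauK tau'K] := injF_bij tau_inj.
(* T (R i) and T (R ord0) are supported on the single rows tau i and tau ord0, so
   one coefficient of the left multiplier relates these two rows. *)
have b_rank1 i : exists u, forall j, b (i, j) = u * b (ord0, j).
  have [[U defU] _] : greenL (T (R i)) (T (R ord0)).
    by apply: presT; split; apply: le_R.
  exists (U (tau i) (tau ord0)) => j.
  have := TE (R i) i j; rewrite defU [R i i j]mxE eqxx mulr1 => <-.
  rewrite mxE (bigD1 (tau ord0)) //= big1 => [|a ane].
    by rewrite TE mxE eqxx mulr1 addr0.
  rewrite -[a]tau'K TE mxE; case: eqP => [a0|]; last by rewrite !mulr0.
  by case/eqP: ane; rewrite -a0 tau'K.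
have [u bE] := fin_all_exists b_rank1.
have u0 i : u i != 0.
  by have := b0 (i, ord0); rewrite bE; apply: contraNneq => ->; rewrite mul0r.
have [P' PP'] := monomial_mx_inv tau_inj u0.
have [Q' [QQ' Q'Q]] := monomial_mx_inv pi_inj (fun j => b0 (ord0, j)).
exists (monomial_mx tau u), P', (monomial_mx pi (fun j => b (ord0, j)))^T, Q'^T.
split=> //; first by split; rewrite -trmx_mul ?QQ' ?Q'Q trmx1.
move=> A; apply/matrixP=> i j; rewrite -[i]tau'K -[j]pi'K TE bE.
set Q := monomial_mx pi _.
(* The right factor is handled as a left factor of the transpose. *)
have -> B : (B *m Q^T) (tau (tau' i)) (pi (pi' j)) =
    (Q *m B^T) (pi (pi' j)) (tau (tau' i)).
  by rewrite -[B in LHS]trmxK -trmx_mul mxE.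
rewrite mul_monomial_mxE // mxE mul_monomial_mxE //.
by rewrite mulrCA mulrA.
Qed.

End Semifield.

Theorem corollary3p9 (S : comNzSemiRingType) (n : nat)
    (T : {linear 'M[S]_n -> 'M[S]_n}) :
  semifield S -> anti_negative S -> (0 < n)%N -> bijective T ->
  preserves (@greenL S n) T \/ preserves (@greenR S n) T \/
  preserves (@green_leL S n) T \/ preserves (@green_leR S n) T ->
  strongly_preserves (@greenL S n) T /\
  strongly_preserves (@greenR S n) T /\
  strongly_preserves (@greenD S n) T /\
  strongly_preserves (@greenJ S n) T /\
  strongly_preserves (@greenH S n) T /\
  strongly_preserves (@green_leL S n) T /\
  strongly_preserves (@green_leR S n) T /\
  strongly_preserves (@green_leJ S n) T.
Proof.
case: n T => // n T fieldS antiS _ bijT presT.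
apply: equivalence_map_strongly_preserves.
have fromL := preserves_greenL_equivalence fieldS antiS.
have fromR : preserves (@greenR S n.+1) T -> equivalence_map T.
  move=> presR; apply: equivalence_map_trmx; apply: fromL.
    have trmx_bij : bijective (@trmx S n.+1 n.+1) by exists trmx; exact: trmxK.
    exact: bij_comp (bij_comp trmx_bij bijT) trmx_bij.
  by move=> A B /greenL_trmx/presR LAB; apply/greenL_trmx; rewrite /= !trmxK.
case: presT => [/(fromL _ _ bijT)|[/fromR|[leT|leT]]] //.
  by apply: fromL => // A B [AB BA]; split; apply: leT.
by apply: fromR => A B [AB BA]; split; apply: leT.
Qed.
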